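(* Let $q$ be a prime power, let $m>4$, let $\alpha\in\mathbb{F}_{q^m}$ be primitive, i.e. $\mathbb{F}_{q^m}^*=\langle\alpha\rangle$, and let $\gamma\in\mathbb{F}_q$ be a quadratic non-residue in $\mathbb{F}_q$ such that $\gamma\neq(\alpha^{[s]}+\alpha)^2$ for every $0<s<m$ with $\gcd(s,m)=1$. Then \[G=\begin{pmatrix}1&0&\alpha&\alpha^2\\0&1&\alpha^2&\gamma\alpha\end{pmatrix}\] is a generator matrix of an MRD code $\mathcal{C}\subseteq\mathbb{F}_{q^m}^4$ of dimension $k=2$ that is not a generalized Gabidulin code.
   Context: Notation: $[i]:=q^i$. A quadratic non-residue in $\mathbb{F}_q$ is an element of $\mathbb{F}_q$ that is not a square in $\mathbb{F}_q$. The rank over $\mathbb{F}_q$ of $\boldsymbol{x}=(x_1,\dots,x_n)\in\mathbb{F}_{q^m}^n$ is $\dim_{\mathbb{F}_q}\langle x_1,\dots,x_n\rangle_{\mathbb{F}_q}$, and the minimum rank distance of a nonzero linear code is the minimum rank of its nonzero codewords. A nonzero $\mathbb{F}_{q^m}$-linear code in $\mathbb{F}_{q^m}^n$ of dimension $k$ (over $\mathbb{F}_{q^m}$) is an MRD code if its minimum rank distance equals $n-k+1$. A generalized Gabidulin code of dimension $k$ is a linear code in $\mathbb{F}_{q^m}^n$ having, for some $s\in\mathbb{N}$ with $\gcd(s,m)=1$ and some $g_1,\dots,g_n\in\mathbb{F}_{q^m}$ linearly independent over $\mathbb{F}_q$, a generator matrix whose $i$-th row is $(g_1^{[s(i-1)]},\dots,g_n^{[s(i-1)]})$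 for $i=1,\dots,k$. *)

(* Defs.v *)
From HB Require Import structures.
From mathcomp Require Import all_boot all_order all_algebra all_field.

Set Implicit Arguments.
Unset Strict Implicit.
Unset Printing Implicit Defensive.

Import GRing.Theory.
Local Open Scope ring_scope.

(* The extension F_{q^m} / F_q is a field extension L of a finite field F of
   cardinality q, of degree m = \dim {:L}. F_q sits in L through c |-> c%:A. *)

(* Integer exponents: the powers of alpha are the subgroup <alpha> of L^*. *)
Definition primitive_element (L : fieldType) (alpha : L) : Prop :=
  alpha != 0 /\ forall x : L, x != 0 -> exists i : int, x = alpha ^ i.

Definition quadratic_nonresidue (F : fieldType) (c : F) : Prop :=
  ~ exists b : F, b ^+ 2 = c.

Section RankMetricCodes.

Variables (F : finFieldType) (L : fieldExtType F).

Definition rank_weight (n : nat) (x : 'rV[L]_n) : nat :=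
  \dim <<[seq x ord0 j | j : 'I_n]>>%VS.

Definition is_min_rank_distance (n : nat) (C : {vspace 'rV[L]_n}) (d : nat) :
    Prop :=
  (exists c : 'rV[L]_n, [/\ c \in C, c != 0 & rank_weight c = d]) /\
  (forall c : 'rV[L]_n, c \in C -> c != 0 -> (d <= rank_weight c)%N).

(* Here \dim C is the dimension over L. *)
Definition is_MRD (n : nat) (C : {vspace 'rV[L]_n}) : Prop :=
  C != 0%VS /\ is_min_rank_distance C (n - \dim C + 1).

Definition is_generator_matrix (k n : nat) (G : 'M[L]_(k, n))
    (C : {vspace 'rV[L]_n}) : Prop :=
  basis_of C [seq row i G | i : 'I_k].

(* Rows are numbered from 0, so row i carries the exponent [s i] = q ^ (s i). *)
Definition gabidulin_mx (k n s : nat) (g : 'I_n -> L) : 'M[L]_(k, n) :=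
  \matrix_(i < k, j < n) g j ^+ (#|F| ^ (s * i)).

Definition is_generalized_gabidulin (n : nat) (C : {vspace 'rV[L]_n}) : Prop :=
  exists (k s : nat) (g : 'I_n -> L),
    [/\ coprime s (\dim {:L}),
        free [seq g j | j : 'I_n] &
        is_generator_matrix (gabidulin_mx k s g) C].

Definition code_mx (alpha : L) (gamma : F) : 'M[L]_(2, 4) :=
  \matrix_(i < 2, j < 4)
    (nth [::] [:: [:: 1; 0; alpha; alpha ^+ 2];
                  [:: 0; 1; alpha ^+ 2; gamma%:A * alpha]] i)`_j.

End RankMetricCodes.

(* Main.v *)
(* Every codeword is (a, b) G. If (a, b) G has rank at most 2, there are two
   independent vectors u, v over F_q with (a, b) G u = (a, b) G v = 0, so
   det (G (u | v)) = 0. By Cauchy-Binet this is an F_q-combination of 1, alpha,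
   alpha^2, alpha^4 in the Pluecker coordinates p_ij of (u, v). As alpha has
   degree m > 4, all coefficients vanish, and the Pluecker relation becomes
   p_02^2 = gamma p_03^2, which forces all p_ij = 0 since gamma is a
   non-residue.

   If g and g^[s] are the codewords (a, b) G and (c, d) G, then c = a^[s],
   d = b^[s], and comparing the last two entries, after division by
   alpha^[s] - alpha <> 0, gives d (gamma - (alpha^[s] + alpha)^2) = 0. Hence
   d = c = 0, so that g_1 = a = 0. *)

Require Import Defs.
From HB Require Import structures.
From mathcomp Require Import all_boot all_order all_algebra all_field.
From mathcomp Require Import ring.

Set Implicit Arguments.
Unset Strict Implicit.
Unset Printing Implicit Defensive.

Import GRing.Theory.
Local Open Scope ring_scope.

(** If [v] has a nonzero coordinate [j], the minors through [j] force [u] to be the multiple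
    [u_j / v_j] of [v]; otherwise [v = 0]. *)
Lemma free2_minor (K : fieldType) n (u v : 'rV[K]_n) :
  (forall i j, u ord0 i * v ord0 j = u ord0 j * v ord0 i) -> ~~ free [:: u; v].
Proof.
move=> minor0; apply/negP; rewrite free_cons seq1_free span_seq1.
case/andP=> + v_neq0; case: (pickP (fun j => v ord0 j != 0)) => [j vj|v0].
  case/vlineP; exists (u ord0 j / v ord0 j); apply/rowP=> i.
  by rewrite mxE mulrAC -minor0 mulfK.
case/negP: v_neq0; apply/eqP/rowP=> j; rewrite mxE.
by have := v0 j => /= /negbFE/eqP.
Qed.

Lemma coprime_gt0l s m : (1 < m)%N -> coprime s m -> (0 < s)%N.
Proof. by case: s => // m_gt1; rewrite /coprime gcd0n (gtn_eqF m_gt1). Qed.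

Section FiniteFieldExtension.

Variables (F : finFieldType) (L : fieldExtType F).

(** * Frobenius powers on the extension *)

Lemma expD_card (x y : L) s :
  (x + y) ^+ (#|F| ^ s) = x ^+ (#|F| ^ s) + y ^+ (#|F| ^ s).
Proof.
have [p p_pr pcharFp] := finPcharP F.
(* The exponent is a power of the characteristic, which [F] and [L] share. *)
apply: exprDn_pchar; rewrite (card_pprimeChar pcharFp) -expnM.
rewrite (eq_pnat _ (pchar_lalg L)) (eq_pnat _ (pcharf_eq pcharFp)).
by rewrite pnatX pnat_id.
Qed.

Lemma exp_alg_card (c : F) s : (c%:A : L) ^+ (#|F| ^ s) = c%:A.
Proof.
elim: s => [|s IHs]; first by rewrite expr1.
by rewrite expnS exprM -[c%:A]/(in_alg L c) -rmorphXn expf_card.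
Qed.

Lemma exp_card_mul (x : L) n k :
  x ^+ (#|F| ^ n) = x -> x ^+ (#|F| ^ (k * n)) = x.
Proof.
by move=> fix_x; elim: k => [|k IHk]; rewrite ?expr1 // mulSn expnD exprM fix_x.
Qed.

Lemma exp_card_dim (x : L) k : x ^+ (#|F| ^ (k * \dim {:L})) = x.
Proof.
by apply/exp_card_mul/eqP; rewrite -(Fermat's_little_theorem {:L}%AS) memvf.
Qed.

(** * Degree and Frobenius orbit of a primitive element *)

Lemma primitive_Fadjoin (alpha : L) :
  primitive_element alpha -> <<1; alpha>>%VS = fullv.
Proof.
case=> alpha_neq0 gen; apply/eqP; rewrite eqEsubv subvf /=.
apply/subvP=> x _; have [->|x_neq0] := eqVneq x 0; first exact: mem0v.
have [i ->] := gen x x_neq0; have a_in := memv_adjoin 1%VS alpha.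
by case: i => n; rewrite ?NegzE /= ?rpredV rpredX.
Qed.

Lemma primitive_adjoin_degree (alpha : L) :
  primitive_element alpha -> adjoin_degree 1%VS alpha = \dim {:L}.
Proof.
by move=> /primitive_Fadjoin eqL; rewrite adjoin_degreeE eqL dimv1 divn1.
Qed.

(** The minimal polynomial of [alpha] over [F] has degree [\dim {:L}], which exceeds the degree of
    any nonzero [p] of this size. *)
Lemma poly_root_eq0 (alpha : L) (p : {poly F}) :
    primitive_element alpha -> (size p <= \dim {:L})%N ->
  (map_poly (in_alg L) p).[alpha] = 0 -> p = 0.
Proof.
move=> prim le_p /eqP.
rewrite -/(root _ _) (root_small_adjoin_poly (K := 1%AS)).
- by rewrite map_poly_eq0 => /eqP.
- exact: alg_polyOver.
- by rewrite size_map_poly primitive_adjoin_degree.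
Qed.

Lemma primitive_exp_card_neq (alpha : L) s :
    primitive_element alpha -> (1 < \dim {:L})%N -> coprime s (\dim {:L}) ->
  alpha ^+ (#|F| ^ s) != alpha.
Proof.
move=> prim m_gt1 co_sm; apply/eqP=> fix_s.
(* Bezout in natural numbers, [u * s = v * m + 1] with [m = \dim {:L}]: fixed by the powers [q ^ s]
   and [q ^ m], [alpha] is fixed by the power [q]. Hence it lies in [F], and [L = F], against
   [m > 1]. *)
have [u v eq_uv _] := egcdnP (\dim {:L}) (coprime_gt0l m_gt1 co_sm).
have : alpha \in 1%VS.
  rewrite (Fermat's_little_theorem 1%AS) dimv1 expn1; apply/eqP.
  rewrite -[RHS](exp_card_mul u fix_s) eq_uv (eqP co_sm) expnD exprM.
  by rewrite exp_card_dim.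
move/(Fadjoin_idP (K := 1%AS)); rewrite primitive_Fadjoin // => full1.
by move: m_gt1; rewrite full1 dimv1.
Qed.

(** * Rank and relations between coordinates *)

Lemma small_rank_relations n (x : 'rV[L]_n) d :
    (rank_weight x + d <= n)%N ->
  exists2 U : {vspace 'rV[F]_n}, (d <= \dim U)%N &
    forall u, u \in U -> \sum_j u ord0 j *: x ord0 j = 0.
Proof.
move=> le_n.
pose f (u : 'rV[F]_n) : L := \sum_j u ord0 j *: x ord0 j.
have f_lin : linear f.
  move=> c u v; rewrite /f scaler_sumr -big_split /=; apply: eq_bigr => j _.
  by rewrite !mxE scalerDl scalerA.
have dim_rV : \dim {:'rV[F]_n} = n by rewrite dimvf dim_matrix; apply: mul1n.
pose fL : {linear 'rV[F]_n -> L} :=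
  HB.pack f (GRing.isLinear.Build _ _ _ _ f f_lin).
(* Rank-nullity: the image lies in the span of the coordinates of [x], so the kernel has dimension
   at least [n - rank_weight x]. *)
exists (lker (linfun fL)) => [|u]; last by rewrite memv_ker lfunE => /eqP.
have := limg_ker_dim (linfun fL) fullv; rewrite capfv dim_rV.
suff : (\dim (limg (linfun fL)) <= rank_weight x)%N.
  move=> le_img eq_n; rewrite -(leq_add2l (rank_weight x)).
  by apply: leq_trans le_n _; rewrite -[X in (X <= _)%N]eq_n addnC leq_add2r.
apply: dimvS; apply/subvP=> _ /memv_imgP[u _ ->]; rewrite lfunE /= /f.
apply: memv_suml => j _; apply/memvZ/memv_span/imageP.
by exists j.
Qed.

Lemma two_relations n (x : 'rV[L]_n) :
    (rank_weight x + 2 <= n)%N ->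
  exists u v : 'rV[F]_n, [/\ free [:: u; v],
    \sum_j u ord0 j *: x ord0 j = 0 & \sum_j v ord0 j *: x ord0 j = 0].
Proof.
move=> /small_rank_relations[U dimU Urel].
have /andP[_ freeU] := vbasisP U.
have inU w : w \in tval (vbasis U) -> w \in U := @vbasis_mem _ _ w U.
have sizeU := size_tuple (vbasis U).
case: (tval (vbasis U)) inU freeU sizeU => [|u [|v s]] inU freeU sizeU;
  rewrite -sizeU // in dimU.
exists u, v; split; first exact: (catl_free (Y := s)).
- by apply: Urel; apply: inU; rewrite inE eqxx.
- by apply: Urel; apply: inU; rewrite !inE eqxx orbT.
Qed.

(** * The code and its minimum rank distance *)

Section CodeMx.

Variables (alpha : L) (gamma : F).

Definition codeword (a b : L) : 'rV[L]_4 :=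
  a *: row 0 (code_mx alpha gamma) + b *: row 1 (code_mx alpha gamma).

Lemma codewordE a b (j : 'I_4) : codeword a b ord0 j =
  [:: a; b; a * alpha + b * alpha ^+ 2;
      a * alpha ^+ 2 + b * (gamma%:A * alpha)]`_j.
Proof.
by rewrite !mxE; case: j => -[|[|[|[|//]]]] ltj /=;
  rewrite ?mulr1 ?mulr0 ?addr0 ?add0r.
Qed.

Lemma code_rows : [seq row i (code_mx alpha gamma) | i : 'I_2] =
  [:: row 0 (code_mx alpha gamma); row 1 (code_mx alpha gamma)].
Proof.
rewrite /image_mem !enum_ordSl (size0nil (size_enum_ord 0)) /=.
by congr [:: _; row _ _]; apply: val_inj.
Qed.

Lemma memv_code c :
  reflect (exists a b, c = codeword a b)
          (c \in <<[seq row i (code_mx alpha gamma) | i : 'I_2]>>%VS).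
Proof.
rewrite code_rows span_cons span_seq1; apply: (iffP memv_addP).
  by case=> _ /vlineP[a ->] [_ /vlineP[b ->] ->]; exists a, b.
move=> [a [b ->]]; exists (a *: row 0 (code_mx alpha gamma)).
  exact/vlineP/(ex_intro _ a).
exists (b *: row 1 (code_mx alpha gamma)) => //.
exact/vlineP/(ex_intro _ b).
Qed.

Lemma free_code_rows : free [seq row i (code_mx alpha gamma) | i : 'I_2].
Proof.
rewrite code_rows free_cons seq1_free span_seq1; apply/andP; split.
  apply/negP=> /vlineP[k] /rowP/(_ 0); rewrite !mxE /= mulr0 => /eqP.
  by rewrite oner_eq0.
apply/eqP=> /rowP/(_ 1); rewrite !mxE /= => /eqP.
by rewrite oner_eq0.
Qed.

Lemma rank_codeword_ge3 a b :
    primitive_element alpha -> quadratic_nonresidue gamma -> (4 < \dim {:L})%N ->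
  codeword a b != 0 -> (3 <= rank_weight (codeword a b))%N.
Proof.
move=> prim nonres m_gt4 cw_neq0; rewrite leqNgt ltnS; apply/negP=> le2.
have /two_relations[u [v [free_uv]]] : (rank_weight (codeword a b) + 2 <= 4)%N.
  by rewrite (leq_add2r 2 _ 2).
(* An opaque copy of in_alg, so that [ring] sees a morphism where /= would
   expose scalings. *)
have [f def_f] : {f : {rmorphism F -> L} | f = in_alg L} by exists (in_alg L).
have fE c (x : L) : c *: x = f c * x by rewrite def_f mulr_algl.
(* [P w] and [Q w] are the two entries of the matrix applied to [w]. *)
pose P (w : 'rV_4) := f (w 0 0) + f (w 0 2) * alpha + f (w 0 3) * alpha ^+ 2.
pose Q (w : 'rV_4) :=
  f (w 0 1) + f (w 0 2) * alpha ^+ 2 + f (w 0 3) * (f gamma * alpha).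
have relE (w : 'rV_4) :
    \sum_j w ord0 j *: codeword a b ord0 j = a * P w + b * Q w.
  rewrite !big_ord_recr big_ord0 /= !codewordE /= add0r !fE mulr1 /P /Q.
  rewrite (_ : widen_ord _ _ = 0); last exact: val_inj.
  rewrite (_ : widen_ord _ _ = 1); last exact: val_inj.
  rewrite (_ : widen_ord _ _ = 2); last exact: val_inj.
  rewrite (_ : ord_max = 3); last exact: val_inj.
  ring.
rewrite !relE => eq_u eq_v.
pose pl i j := u 0 i * v 0 j - u 0 j * v 0 i.
(* The determinant [P u * Q v - P v * Q u], sorted by powers of [alpha]. The cubic coefficient is 0
   because only [pl 2 2] and [pl 3 3] contribute to it. *)
pose p := Poly [:: pl 0 1; gamma * pl 0 3 - pl 1 2;
  pl 0 2 + gamma * pl 2 3 - pl 1 3; 0; - pl 2 3].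
have root_p : (map_poly f p).[alpha] = P u * Q v - P v * Q u.
  by rewrite map_Poly_id0 ?rmorph0 // horner_Poly /= /P /Q /pl; ring.
have root0 : (map_poly f p).[alpha] = 0.
  apply/eqP; apply: contraR cw_neq0 => root_neq0.
  (* Cramer's rule: a nonzero determinant would force [a = b = 0]. *)
  have ap : a * (map_poly f p).[alpha] =
      (a * P u + b * Q u) * Q v - (a * P v + b * Q v) * Q u.
    by rewrite root_p; ring.
  have bp : b * (map_poly f p).[alpha] =
      (a * P v + b * Q v) * P u - (a * P u + b * Q u) * P v.
    by rewrite root_p; ring.
  move/eqP: ap; rewrite eq_u eq_v !mul0r subrr mulf_eq0 (negPf root_neq0) orbF.
  move=> /eqP a0.
  move/eqP: bp; rewrite eq_u eq_v !mul0r subrr mulf_eq0 (negPf root_neq0) orbF.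
  move=> /eqP b0.
  by rewrite /codeword a0 b0 !scale0r addr0.
have p0 : p = 0.
  (* Five coefficients, so the size is at most 5, and [4 < \dim {:L}] applies. *)
  rewrite def_f in root0; apply: poly_root_eq0 root0 => //.
  exact: (leq_trans (size_Poly _)).
have coef0 i : [:: pl 0 1; gamma * pl 0 3 - pl 1 2;
    pl 0 2 + gamma * pl 2 3 - pl 1 3; 0; - pl 2 3]`_i = 0.
  by rewrite -coef_Poly -/p p0 coef0.
have pl01 : pl 0 1 = 0 := coef0 0.
have pl23 : pl 2 3 = 0 by apply/eqP; rewrite -oppr_eq0; apply/eqP/(coef0 4).
have /eqP := coef0 1%N; rewrite subr_eq0 => /eqP /= pl12.
have /eqP := coef0 2%N; rewrite /= pl23 mulr0 addr0 subr_eq0 => /eqP pl13.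
have plucker : pl 0 1 * pl 2 3 - pl 0 2 * pl 1 3 + pl 0 3 * pl 1 2 = 0.
  by rewrite /pl; ring.
have pl03 : pl 0 3 = 0.
  (* After substitution the Pluecker relation reads [pl 0 2 ^+ 2 = gamma * pl 0 3 ^+ 2], so this
     quotient would be a square root of [gamma]. *)
  apply/eqP/negPn/negP=> pl03_neq0; apply: nonres; exists (pl 0 2 / pl 0 3).
  move/eqP: plucker; rewrite pl01 mul0r sub0r -pl13 -pl12 addrC subr_eq0.
  move=> /eqP eq_pl; rewrite expr_div_n expr2 -eq_pl expr2.
  by rewrite mulrCA mulfK // mulf_neq0.
have pl02 : pl 0 2 = 0.
  move/eqP: plucker; rewrite pl01 pl03 -pl13 !mul0r sub0r addr0 oppr_eq0.
  by rewrite mulf_eq0 orbb => /eqP.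
have plN i j : pl i j = 0 -> pl j i = 0.
  by rewrite /pl => /eqP; rewrite subr_eq0 => /eqP ->; rewrite subrr.
have pl_all i j : pl i j = 0.
  move: pl12 pl13; rewrite pl03 mulr0 pl02 => /esym pl12 /esym pl13.
  have ord4 (k : 'I_4) : [\/ k = 0, k = 1, k = 2 | k = 3].
    by case: k => -[|[|[|[|//]]]] ltk; [apply: Or41 | apply: Or42
      | apply: Or43 | apply: Or44]; apply: val_inj.
  by case: (ord4 i) => ->; case: (ord4 j) => -> //; try (exact: plN);
    rewrite /pl subrr.
apply: (negP (free2_minor _) free_uv) => i j.
by apply/eqP; rewrite -subr_eq0; apply/eqP/pl_all.
Qed.

End CodeMx.

End FiniteFieldExtension.

Theorem theorem5p5 (q m : nat) (F : finFieldType) (L : fieldExtType F)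
  (hq : #|F| = q) (hm : \dim {:L} = m) (m_gt4 : (4 < m)%N)
  (alpha : L) (halpha : primitive_element alpha)
  (gamma : F) (hgamma : quadratic_nonresidue gamma)
  (hgamma_alpha : forall s : nat, (0 < s < m)%N -> coprime s m ->
     gamma%:A <> (alpha ^+ (q ^ s) + alpha) ^+ 2 :> L) :
  exists C : {vspace 'rV[L]_4},
    [/\ is_generator_matrix (code_mx alpha gamma) C,
        \dim C = 2%N,
        is_MRD C &
        ~ is_generalized_gabidulin C].
Proof.
pose C := <<[seq row i (code_mx alpha gamma) | i : 'I_2]>>%VS.
have dimC : \dim C = 2%N.
  by rewrite (eqP (free_code_rows alpha gamma)) size_image card_ord.
exists C; split=> //.
- by rewrite /is_generator_matrix /basis_of eqxx free_code_rows.
- split; first by rewrite -dimv_eq0 dimC.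
  rewrite dimC; split=> [|c]; last first.
    by case/memv_code=> [a [b ->]]; apply: rank_codeword_ge3; rewrite ?hm.
  (* The first row attains the distance 3: its entries lie in the span of [1], [alpha] and
     [alpha ^+ 2]. *)
  have cw_neq0 : codeword alpha gamma 1 0 != 0.
    apply/eqP=> /rowP/(_ 0); rewrite codewordE mxE /= => /eqP.
    by rewrite oner_eq0.
  exists (codeword alpha gamma 1 0); split=> //.
    by apply/memv_code; exists 1, 0.
  apply/eqP; rewrite eqn_leq rank_codeword_ge3 ?hm // andbT.
  apply: leq_trans (dim_span [:: 1; alpha; alpha ^+ 2]).
  apply/dimvS/span_subvP=> _ /imageP[j _ ->]; rewrite codewordE.
  rewrite !mul1r !mul0r !addr0; case: j => -[|[|[|[|//]]]] ltj /=.
  - by apply: memv_span; rewrite inE eqxx.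
  - exact: mem0v.
  - by apply: memv_span; rewrite !inE eqxx orbT.
  - by apply: memv_span; rewrite !inE eqxx !orbT.

(* Comparison with generalized Gabidulin codes *)
case=> k [s] [g] [co_sm free_g /andP[/eqP spanC freeC]].
have k2 : k = 2%N.
  by rewrite -dimC -spanC (eqP freeC) size_image card_ord.
move: freeC spanC; rewrite {}k2 => _ spanC.
have rowC i : row i (gabidulin_mx 2 s g) \in C.
  by rewrite -spanC memv_span //; apply/imageP; exists i.
have /memv_code[a [b ab]] := rowC 0.
have /memv_code[c [d cd]] := rowC 1.
have gE j : g j = codeword alpha gamma a b 0 j.
  by rewrite -ab !mxE muln0 expn0 expr1.
have gsE j : codeword alpha gamma c d 0 j = g j ^+ (q ^ s).
  by rewrite -cd !mxE muln1 -hq.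
set beta := alpha ^+ (q ^ s).
have co_sm' : coprime s m by rewrite -hm.
have neq_beta : beta - alpha != 0.
  rewrite subr_eq0 /beta -hq; apply: primitive_exp_card_neq => //.
  by rewrite hm; apply: leq_trans m_gt4.
have frobD x y : (x + y : L) ^+ (q ^ s) = x ^+ (q ^ s) + y ^+ (q ^ s).
  by rewrite -hq expD_card.
(* The first two columns of the matrix form the identity, so the first two coordinates of a codeword
   are its coefficients. *)
have Ec : c = a ^+ (q ^ s) by have := gsE 0; rewrite gE !codewordE.
have Ed : d = b ^+ (q ^ s) by have := gsE 1; rewrite gE !codewordE.
have gamma_fix : (gamma%:A : L) ^+ (q ^ s) = gamma%:A.
  by rewrite -hq exp_alg_card.
have beta2 : (alpha ^+ 2) ^+ (q ^ s) = beta ^+ 2 by rewrite exprAC.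
have eq2 : c * alpha + d * alpha ^+ 2 = c * beta + d * beta ^+ 2.
  have := gsE 2; rewrite gE !codewordE /= frobD (exprMn _ a) (exprMn _ b).
  by rewrite -Ec -Ed beta2.
have eq3 : c * alpha ^+ 2 + d * (gamma%:A * alpha) =
    c * beta ^+ 2 + d * (gamma%:A * beta).
  have := gsE 3; rewrite gE !codewordE /= frobD (exprMn _ a) (exprMn _ b).
  by rewrite -Ec -Ed beta2 (exprMn _ gamma%:A) gamma_fix.
(* The difference of the two sides of [eq2] is divisible by [beta - alpha]; likewise for [eq3]
   below. *)
have sum2 : c + d * (beta + alpha) = 0.
  apply: (mulfI neq_beta); rewrite mulr0.
  by rewrite -(subrr (c * alpha + d * alpha ^+ 2)) {1}eq2; ring.
have sum3 : c * (beta + alpha) + d * gamma%:A = 0.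
  apply: (mulfI neq_beta); rewrite mulr0.
  by rewrite -(subrr (c * alpha ^+ 2 + d * (gamma%:A * alpha))) {1}eq3; ring.
have gamma_neq : gamma%:A != (beta + alpha) ^+ 2.
  (* [s] may exceed [m], so it is reduced modulo [m], which leaves [beta] unchanged; the remainder
     is positive since it is coprime to [m > 1]. *)
  apply/eqP; rewrite /beta (divn_eq s m) expnD exprM.
  rewrite -{1}hq -{2}hm exp_card_dim.
  apply: hgamma_alpha; rewrite ?coprime_modl //.
  rewrite ltn_pmod ?(leq_trans _ m_gt4) // andbT.
  by apply: (@coprime_gt0l _ m); rewrite ?coprime_modl ?(leq_trans _ m_gt4).
have d0 : d = 0.
  apply/eqP; have /eqP : d * (gamma%:A - (beta + alpha) ^+ 2) = 0.
    (* Elimination of [c] between [sum2] and [sum3]. *)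
    transitivity ((c * (beta + alpha) + d * gamma%:A)
                  - (c + d * (beta + alpha)) * (beta + alpha)); first by ring.
    by rewrite sum2 sum3 mul0r subrr.
  by rewrite mulf_eq0 (subr_eq0 gamma%:A) (negPf gamma_neq) orbF.
have c0 : c = 0 by move: sum2; rewrite d0 mul0r addr0.
have a0 : a = 0 by move/eqP: Ec; rewrite c0 eq_sym expf_eq0 => /andP[_ /eqP].
(* The coordinate [g 0 = a] vanishes, which a free family excludes. *)
have : g 0 \in [seq g j | j : 'I_4] by apply/imageP; exists 0.
by move/(free_not0 free_g) => /eqP[]; rewrite gE codewordE /= a0.
Qed.
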